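(* Let $G$ be a graph satisfying $\mathcal{E}_1$. Then a finite path $t\colon\llbracket 0,b\rrbracket\to G$ can be extended to a one-way infinite Eulerian path on $G$ if and only if it satisfies the following three conditions: (1) $G-t$ is connected; (2) the initial vertex of $t$ is distinguished in $G$; (3) there is an edge $e$ incident to the final vertex of $t$ which was not visited by $t$. Moreover, a vertex of $G$ is the initial vertex of a one-way infinite Eulerian path on $G$ if and only if it is distinguished in $G$.
   Context: Graphs are undirected, finite or infinite; loops and multiple edges are allowed. Each edge joins a pair of (possibly equal) vertices and is incident to them. The degree $\deg_G(v)\in\mathbb{N}\cup\{\infty\}$ is the number of edges incident to $v$, loops counted twice; ''even degree'' or ''odd degree'' means finite and even, resp. finite and odd. A graph is finite if its edge set is finite, and infinite otherwise. $0\in\mathbb{N}$. A graph homomorphism sends vertices to vertices and edges to edges, compatibly with incidence. $\llbracket a,b\rrbracket$ (integers $a\le b$) is the graph with vertex set $\{a,\dots,b\}$ and an edge $\{c,c+1\}$ joining $c$ to $c+1$ for each $a\le c<b$; $\llbracket\mathbb{N}\rrbracket$ is defined similarly. A path, also called finite path (resp. one-way infinite path), on $G$ is a graph homomorphism from some $\llbracket a,b\rrbracket$ (resp. from $\llbracket\mathbb{N}\rrbracket$) to $G$ that does not repeat edges (vertices may repeat). It visits the vertices and edges in its image, and is Eulerian if it visits every edge of $G$ exactly once. The initial and final vertices of $t\colon\llbracket a,b\rrbracket\to G$ are $t(a)$ and $t(b)$; the initial vertex of a one-way infinite path $T$ is $T(0)$. A one-way infinite path extends the finite path $t$ if its restriction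 to the domain of $t$ equals $t$. $G$ is connected if every pair of vertices is joined by a path. For a set of edges $E\subset E(G)$, $G-E$ is the graph obtained by removing the edges in $E$ and then all vertices left without incident edges; for a path $t$, $G-t$ is $G-E$ with $E$ the set of edges visited by $t$. A connected component is a maximal connected subgraph. The number of ends of $G$ is the supremum, over finite sets $E$ of edges, of the number of infinite connected components of $G-E$. $G$ satisfies $\mathcal{E}_1$ if: $E(G)$ is countable and infinite; $G$ is connected; either $G$ has exactly one vertex with odd degree, or $G$ has at least one vertex with infinite degree and no vertices with odd degree; $G$ has one end. Distinguished vertices of a graph $G$ satisfying $\mathcal{E}_1$: if $G$ has one vertex with odd degree, then this is its only distinguished vertex; if $G$ has no vertex with odd degree, then the distinguished vertices are exactly the vertices with infinite degree. *)

(* Defs.v *)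
From mathcomp Require Import all_boot all_order all_algebra.
From mathcomp Require Import boolp classical_sets functions cardinality.

Set Implicit Arguments.
Unset Strict Implicit.
Unset Printing Implicit Defensive.

Import Order.TTheory GRing.Theory Num.Theory.

Local Open Scope classical_set_scope.
Local Open Scope card_scope.

(* Undirected multigraphs: an edge is mapped to the set of its endpoints, which
   has two elements, or only one when the edge is a loop. *)
Record graph := Graph {
  vertex : Type;
  edge : Type;
  ends : edge -> set vertex;
  ends_pair : forall e, exists x y, ends e = [set x; y] }.

Arguments ends {g} e.

Definition incident (G : graph) (e : edge G) (v : vertex G) : Prop := ends e v.

(* The pairs (e, false) with e incident to v, together with the pairs (e, true)
   with e a loop at v: a loop at v contributes two elements. *)
Definition half_edges (G : graph) (v : vertex G) : set (edge G * bool) :=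
  [set h | incident h.1 v /\ (h.2 = true -> ends h.1 = [set v])].

Definition has_degree (G : graph) (v : vertex G) (n : nat) : Prop :=
  half_edges v #= `I_n.

Definition odd_degree (G : graph) (v : vertex G) : Prop :=
  exists2 n, odd n & has_degree v n.

Definition infinite_degree (G : graph) (v : vertex G) : Prop :=
  infinite_set (half_edges v).

Definition infinite_graph (G : graph) : Prop := infinite_set [set: edge G].

Record hom (P G : graph) := Hom {
  hom_vertex :> vertex P -> vertex G;
  hom_edge : edge P -> edge G;
  hom_ends : forall e, ends (hom_edge e) = hom_vertex @` ends e }.

Section Segment.
Local Open Scope ring_scope.
Variables a b : int.

Let segV := {c : int | a <= c <= b}.
Let segE := {c : int | a <= c < b}.
Let seg_ends (e : segE) : set segV :=
  [set v | val v = val e \/ val v = val e + 1].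

Fact segment_ends_pair (e : segE) : exists x y, seg_ends e = [set x; y].
Proof.
case: e => c hc; have /andP[ac cb] := hc.
have h0 : a <= c <= b by rewrite ac ltW.
have h1 : a <= c + 1 <= b by rewrite lezD1 cb andbT (le_trans ac) // lerDl.
exists (exist _ c h0), (exist _ (c + 1) h1).
apply/seteqP; split => v /=.
  by case=> hv; [left | right]; apply: val_inj.
by case=> ->; [left | right].
Qed.

Definition segment : graph := Graph segment_ends_pair.

Hypothesis ab : a <= b.

Fact segment_fst_subproof : a <= a <= b. Proof. by rewrite lexx. Qed.
Fact segment_lst_subproof : a <= b <= b. Proof. by rewrite ab lexx. Qed.

Definition segment_fst : vertex segment := exist _ a segment_fst_subproof.
Definition segment_lst : vertex segment := exist _ b segment_lst_subproof.

End Segment.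

Fact ray_ends_pair (c : nat) : exists x y : nat, [set c; c.+1] = [set x; y].
Proof. by exists c, c.+1. Qed.

Definition ray : graph := Graph ray_ends_pair.

(* Paths of shape P: a finite path is a path of shape [segment a b] with a <= b,
   a one-way infinite path is a path of shape [ray]. *)
Record gpath (P G : graph) := GPath {
  gpath_hom :> hom P G;
  gpath_inj : injective (hom_edge gpath_hom) }.

Definition visited_edges (P G : graph) (t : gpath P G) : set (edge G) :=
  range (hom_edge t).

Definition eulerian (P G : graph) (t : gpath P G) : Prop :=
  forall e : edge G, exists! c : edge P, hom_edge t c = e.

Definition initial_vertex (G : graph) (a b : int) (ab : (a <= b)%R)
  (t : gpath (segment a b) G) : vertex G := t (segment_fst ab).

Definition final_vertex (G : graph) (a b : int) (ab : (a <= b)%R)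
  (t : gpath (segment a b) G) : vertex G := t (segment_lst ab).

Definition ray_initial_vertex (G : graph) (T : gpath ray G) : vertex G :=
  T (0%N : vertex ray).

Definition extends (G : graph) (b : int) (T : gpath ray G)
    (t : gpath (segment 0 b) G) : Prop :=
  (forall (k : vertex ray) (c : vertex (segment 0 b)),
     val c = Posz k -> T k = t c) /\
  (forall (k : edge ray) (c : edge (segment 0 b)),
     val c = Posz k -> hom_edge T k = hom_edge t c).

Definition connected (G : graph) : Prop :=
  forall x y : vertex G, exists (a b : int) (ab : (a <= b)%R)
    (t : gpath (segment a b) G), initial_vertex ab t = x /\ final_vertex ab t = y.

Record subgraph (G : graph) := Subgraph {
  subV : set (vertex G);
  subE : set (edge G);
  sub_closed : forall e, subE e -> ends e `<=` subV }.

Section GraphOfSubgraph.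
Variables (G : graph) (H : subgraph G).

Let sub_ends (e : subE H) : set (subV H) := [set v | ends (val e) (val v)].

Fact sub_ends_pair (e : subE H) : exists x y, sub_ends e = [set x; y].
Proof.
have [x [y xyE]] := ends_pair (val e).
have sub := sub_closed (set_mem (valP e)).
have hx : subV H x by apply: sub; rewrite xyE; left.
have hy : subV H y by apply: sub; rewrite xyE; right.
exists (SigSub (mem_set hx)), (SigSub (mem_set hy)).
apply/seteqP; split => v; rewrite /sub_ends /= xyE.
  by case=> hv; [left | right]; apply: val_inj.
by case=> ->; [left | right].
Qed.

Definition graph_of_subgraph : graph := Graph sub_ends_pair.

End GraphOfSubgraph.

Coercion graph_of_subgraph : subgraph >-> graph.

Definition subgraph_le (G : graph) (H K : subgraph G) : Prop :=
  subV H `<=` subV K /\ subE H `<=` subE K.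

Fact del_edges_closed (G : graph) (F : set (edge G)) (e : edge G) :
  (~` F) e -> ends e `<=` [set v | exists2 e', (~` F) e' & incident e' v].
Proof. by move=> Fe v ev; exists e. Qed.

(* Vertices left without incident edges are removed. *)
Definition del_edges (G : graph) (F : set (edge G)) : subgraph G :=
  Subgraph (@del_edges_closed G F).

Definition del_path (P G : graph) (t : gpath P G) : subgraph G :=
  del_edges (visited_edges t).

Definition component (G : graph) (C : subgraph G) : Prop :=
  connected C /\
  forall D : subgraph G, connected D -> subgraph_le C D -> subgraph_le D C.

Definition infinite_components (G : graph) : set (subgraph G) :=
  [set C | component C /\ infinite_graph C].
Arguments infinite_components : clear implicits.

Definition ends_bound (G : graph) (n : nat) : Prop :=
  forall F : set (edge G), finite_set F ->
    infinite_components (del_edges F) #<= `I_n.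

(* The supremum defining the number of ends is the finite number n. *)
Definition has_number_of_ends (G : graph) (n : nat) : Prop :=
  ends_bound G n /\ forall m, ends_bound G m -> n <= m.

Record E1 (G : graph) : Prop := MkE1 {
  E1_countable : countable [set: edge G];
  E1_infinite : infinite_graph G;
  E1_connected : connected G;
  E1_degrees : (exists! v : vertex G, odd_degree v) \/
    ((exists v : vertex G, infinite_degree v) /\
     forall v : vertex G, ~ odd_degree v);
  E1_ends : has_number_of_ends G 1 }.

(* Only meaningful when E1 G holds. *)
Definition distinguished (G : graph) (v : vertex G) : Prop :=
  ((exists! u : vertex G, odd_degree u) /\ odd_degree v) \/
  ((forall u : vertex G, ~ odd_degree u) /\ infinite_degree v).

(* Main.v *)
Require Import Defs.
From HB Require Import structures.
From mathcomp Require Import all_boot all_order all_algebra finmap zify.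
From mathcomp Require Import boolp classical_sets functions cardinality.

(** A trail is a walk that repeats no edge.  The handshake parity of a walk
    from x to y says that it uses an odd number of half-edges at v exactly when
    v is one of x, y but not both ([odd_degree_walk]).  Counting along an
    Eulerian ray from x0, up to a moment after which the vertex v of finite
    degree is never met again, gives that v has odd degree iff v = x0
    ([eulerian_ray_only_odd_at]).  Under E1 this property of x0,
    [only_odd_at x0], is the same as being distinguished
    ([distinguished_only_odd_at]), so all the degree hypotheses and conclusions
    are expressed by it.

    Conversely, let x0 have this property and let q be a trail from x0 to u
    whose removal leaves a connected graph.  The ray is obtained by extending q
    again and again, keeping the complement connected, so that every edge is
    eventually used ([eulerian_ray]).  The single extension step,
    [extend_trail], visits a prescribed new edge e as follows.

    By parity, u still has an unvisited edge, so u lies in G - q and a trail p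
    of G - q leads from u through e to some w.  As G has one end, G - q - p has
    only one infinite component and finitely many finite ones; adding the edges
    of the latter to those of q and p gives a finite set F' whose removal leaves
    a connected graph ([absorb_finite_components]).  It remains to find a trail
    from u to w which traverses exactly the edges of A = F' - q: this is the
    argument of Euler's theorem ([extend_to_cover]).  While a trail s containing
    p misses edges of A, these edges form, at the vertices which they touch, a
    graph of even degrees apart from w, because each such vertex has all its
    edges in F' and [only_odd_at] determines its degree modulo 2.  A trail of
    unused edges that starts at w and goes on until it is stuck would contradict
    parity, so w is not touched at all; hence such a trail started at a vertex
    of s returns to its origin and can be inserted into s.

    Connectivity is handled through reachability by walks in G that stay in a
    given set of edges; the bridge with homomorphisms from segments into
    subgraphs is [gpath_walk], [walk_gpath] and [connected_subP]. *)

Set Implicit Arguments.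
Unset Strict Implicit.
Unset Printing Implicit Defensive.

Import Order.TTheory GRing.Theory Num.Theory.

Local Open Scope classical_set_scope.
Local Open Scope card_scope.

(** * Walks and reachability *)

(** Edges and vertices are arbitrary types; their equality is decided
    classically, so that lists of edges have membership and [uniq]. *)
HB.instance Definition _ (G : graph) := gen_eqMixin (vertex G).
HB.instance Definition _ (G : graph) := gen_choiceMixin (vertex G).
HB.instance Definition _ (G : graph) := gen_eqMixin (edge G).
HB.instance Definition _ (G : graph) := gen_choiceMixin (edge G).

Section Walks.
Variable G : graph.
Implicit Types (e f : edge G) (x y z v w u : vertex G).
Implicit Types (p q r s : seq (edge G * vertex G)) (F : seq (edge G)).
Implicit Types (A B : set (edge G)).

(** For x = y this says that e is a loop at x. *)
Definition joins e x y := ends e = [set x; y].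

Lemma joins_incident e x y z : joins e x y -> incident e z <-> z = x \/ z = y.
Proof. by rewrite /incident => ->. Qed.

Lemma incident_joins e x : incident e x -> exists y, joins e x y.
Proof.
have [a [b E]] := ends_pair e.
rewrite /incident /joins E => -[->|->]; first by exists b.
by exists a; rewrite setUC.
Qed.

(** Each entry of the list is an edge together with the vertex that it leads to,
    so that walks in both directions along an edge are told apart. *)
Fixpoint walk x p y : Prop :=
  if p is (e, z) :: p' then joins e x z /\ walk z p' y else x = y.

Definition edges p : seq (edge G) := [seq h.1 | h <- p].

Lemma edges_cat p q : edges (p ++ q) = edges p ++ edges q.
Proof. exact: map_cat. Qed.

Lemma walk_catP x p q y :
  walk x (p ++ q) y <-> exists2 z, walk x p z & walk z q y.
Proof.
elim: p x => [|[e a] p IH] x /=; first by split=> [?|[z ->]//]; exists x.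
split=> [[j /IH[z pz qz]]|[z [j pz] qz]]; first by exists z.
by split=> //; apply/IH; exists z.
Qed.

Lemma walk_cat x y z p q : walk x p y -> walk y q z -> walk x (p ++ q) z.
Proof. by move=> *; apply/walk_catP; exists y. Qed.

Lemma walk_split x p y e v : walk x p y -> e \in edges p -> incident e v ->
  exists p1 p2, [/\ p = p1 ++ p2, walk x p1 v & walk v p2 y].
Proof.
elim: p x => [|[f a] p IH] x //= [j pa]; rewrite inE.
have [-> _|_ /= ep] := eqVneq e f => ev.
  have [->|->] := (joins_incident _ j).1 ev; first by exists [::], ((f, a) :: p).
  by exists [:: (f, a)], p.
have [p1 [p2 [-> w1 w2]]] := IH _ pa ep ev.
by exists ((f, a) :: p1), p2.
Qed.

Lemma walk_last_incident x p y : walk x p y -> p <> [::] ->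
  exists2 e, e \in edges p & incident e y.
Proof.
elim: p x => [|[f a] p IH] x //= [j pa] _.
case: p IH pa => [_ /= <-|s p IH pa].
  by exists f; [rewrite inE | apply/(joins_incident _ j); right].
have [//|e ep ey] := IH _ pa.
by exists e => //; rewrite inE ep orbT.
Qed.

Definition reach A x y :=
  exists2 p, walk x p y & forall e, e \in edges p -> A e.

Lemma reach_refl A x : reach A x x.
Proof. by exists [::]. Qed.

Lemma reach_trans A y x z : reach A x y -> reach A y z -> reach A x z.
Proof.
move=> [p wp Ap] [q wq Aq]; exists (p ++ q); first exact: walk_cat wp wq.
by move=> e; rewrite edges_cat mem_cat => /orP[/Ap|/Aq].
Qed.

Lemma reach_edge A e x y : A e -> incident e x -> incident e y -> reach A x y.
Proof.
move=> Ae /incident_joins[z j] /(joins_incident _ j)[] ->.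
  exact: reach_refl.
by exists [:: (e, z)] => //= f; rewrite inE => /eqP->.
Qed.

(** Induction from the target y backwards to x; reachability of y from the
    intermediate vertex z is also available at each step. *)
Lemma reach_ind A y (P : vertex G -> Prop) : P y ->
  (forall e x z, A e -> joins e x z -> reach A z y -> P z -> P x) ->
  forall x, reach A x y -> P x.
Proof.
move=> Py IH x [p]; elim: p x => [|[e z] p IHp] x /=; first by move=> ->.
move=> [j wp] Ap.
have Ap' f : f \in edges p -> A f by move=> fp; apply: Ap; rewrite inE fp orbT.
apply: (IH e _ z) => //; first by apply: Ap; rewrite inE eqxx.
  by exists p.
exact: IHp.
Qed.

Lemma reach_sym A x y : reach A x y -> reach A y x.
Proof.
move: x; apply: reach_ind; first exact: reach_refl.
move=> e x z Ae j _ yz; apply: reach_trans yz _.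
by apply: (reach_edge Ae); apply/(joins_incident _ j); [right|left].
Qed.

Lemma reach_sub A B x y : A `<=` B -> reach A x y -> reach B x y.
Proof. by move=> AB [p wp Ap]; exists p => // e /Ap/AB. Qed.

(** Short-cut whenever the first edge e is used again later: the later passage
    through e meets the origin x of the walk, and the part of the trail after
    that meeting already leads from x to y. *)
Lemma walk_trail x p y : walk x p y ->
  exists q, [/\ walk x q y, uniq (edges q) & {subset edges q <= edges p}].
Proof.
elim: p x => [|[e z] p IH] x /=; first by exists [::].
move=> [j /IH[q [wq uq qp]]].
have qp' : {subset edges q <= e :: edges p}.
  by move=> f /qp; rewrite inE orbC => ->.
have [eq|neq] := boolP (e \in edges q); last first.
  exists ((e, z) :: q); split=> //=; first by rewrite neq.
  by move=> f; rewrite !inE => /orP[->//|/qp->]; rewrite orbT.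
have ex : incident e x by apply/(joins_incident _ j); left.
have [q1 [q2 [qE _ w2]]] := walk_split wq eq ex.
exists q2; split=> //.
  by move: uq; rewrite qE edges_cat cat_uniq => /and3P[].
by move=> f fq; apply: qp'; rewrite qE edges_cat mem_cat fq orbT.
Qed.

End Walks.

(** * Degrees modulo two *)

Section Degrees.
Variable G : graph.
Implicit Types (e f : edge G) (x y z v w u : vertex G).
Implicit Types (p : seq (edge G * vertex G)) (F : seq (edge G)).

(** A loop fills two half-edges at its vertex; [mult e v] is the number of
    half-edges that e contributes at v. *)
Definition mult e v : nat := `[< incident e v >] + `[< ends e = [set v] >].

Definition degree_in F v := \sum_(e <- F) mult e v.

Lemma odd_mult e x y v : joins e x y -> odd (mult e v) = (v == x) (+) (v == y).
Proof.
move=> j; rewrite oddD !oddb.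
have -> : `[< incident e v >] = (v == x) || (v == y).
  by apply/asboolP/orP => [/(joins_incident _ j)[] ->|[]/eqP->];
    rewrite ?eqxx; [left|right|apply/(joins_incident _ j); left
                   |apply/(joins_incident _ j); right].
have -> : `[< ends e = [set v] >] = (v == x) && (v == y).
  apply/asboolP/andP => [|[/eqP vx /eqP vy]]; last by rewrite j -vx -vy setUid.
  rewrite j => E; split; apply/eqP.
    by have : [set v] x by rewrite -E; left.
  by have : [set v] y by rewrite -E; right.
by case: (v == x) (v == y) => [] [].
Qed.

Lemma degree_in_cons e F v : degree_in (e :: F) v = mult e v + degree_in F v.
Proof. exact: big_cons. Qed.

Lemma degree_in_cat F F' v :
  degree_in (F ++ F') v = degree_in F v + degree_in F' v.
Proof. exact: big_cat. Qed.

(** Each step adds both endpoints of its edge modulo two, and the sum of these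
    telescopes. *)
Lemma odd_degree_walk x p y v : walk x p y ->
  odd (degree_in (edges p) v) = (v == x) (+) (v == y).
Proof.
elim: p x => [|[e z] p IH] x /=; first by move=> ->; rewrite /degree_in big_nil addbb.
move=> [j /IH E]; rewrite degree_in_cons oddD E (odd_mult _ j).
by case: (v == x) (v == y) (v == z) => [] [] [].
Qed.

Lemma mult0 e v : ~ incident e v -> mult e v = 0.
Proof.
move=> ev; rewrite /mult asboolF // asboolF // => E.
by apply: ev; rewrite /incident E.
Qed.

(** Edges away from v contribute nothing, so only the edges at v matter. *)
Lemma degree_in_sub F F' v : uniq F -> uniq F' -> {subset F' <= F} ->
  (forall e, e \in F -> incident e v -> e \in F') ->
  degree_in F v = degree_in F' v.
Proof.
move=> uF uF' F'F cF; rewrite /degree_in (bigID (mem F')) /= addnC big_seq_cond.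
rewrite big1 => [|e /andP[eF /negP eF']]; last first.
  by apply: mult0 => ev; apply: eF'; apply: cF.
rewrite add0n -big_filter; apply: perm_big; apply: uniq_perm => //.
  exact: filter_uniq.
by move=> e; rewrite mem_filter /=; case: (boolP (e \in F')) => // /F'F.
Qed.

Definition covers F v := forall e, incident e v -> e \in F.

Lemma card_seq (T : choiceType) (s : seq T) : uniq s -> [set` s] #= `I_(size s).
Proof.
move=> us; have -> : [set` s] = [set` [fset x in s]%fset].
  by apply/seteqP; split=> x /=; rewrite inE.
by apply/card_eq_fsetP; rewrite card_fseq undup_id.
Qed.

Lemma has_degree_covers F v : uniq F -> covers F v ->
  has_degree v (degree_in F v).
Proof.
move=> uF cF; pose s (b : bool) (P : edge G -> Prop) :=
  [seq (e, b) | e <- F & `[< P e >]].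
pose I e := incident e v; pose L e := ends e = [set v].
have -> : degree_in F v = size (s false I ++ s true L).
  rewrite size_cat !size_map !size_filter -!sum1_count /degree_in.
  rewrite [X in _ = X + _]big_mkcond [X in _ = _ + X]big_mkcond -big_split /=.
  by apply: eq_bigr => e _; rewrite /mult; do 2!case: asbool.
rewrite /has_degree.
have -> : half_edges v = [set` s false I ++ s true L].
  apply/seteqP; split=> -[e b] /=; rewrite mem_cat.
    case=> /= ev; case: b => [/(_ erefl) evL|_]; apply/orP; [right|left];
      apply: map_f; rewrite mem_filter cF // andbT; exact/asboolP.
  case/orP=> /mapP[e' + [-> ->]] /=; rewrite mem_filter => /andP[/asboolP H _].
    by split.
  by split=> //=; rewrite /incident H.
apply: card_seq; rewrite cat_uniq !map_inj_uniq ?filter_uniq //=; try by move=> ? ? [].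
rewrite andbT; apply/hasPn => _ /mapP[e _ ->] /=.
by apply/negP => /mapP[? _ []].
Qed.

Lemma finite_degree_covers v : finite_set (half_edges v) ->
  exists2 F, uniq F & covers F v.
Proof.
move=> /finite_seqP[s sE]; exists (undup [seq h.1 | h <- s]).
  exact: undup_uniq.
move=> e ev; rewrite mem_undup; apply/mapP; exists (e, false) => //.
by have : half_edges v (e, false) by []; rewrite sE.
Qed.

Lemma covers_finite_degree F v : uniq F -> covers F v ->
  finite_set (half_edges v).
Proof. by move=> uF cF; exists (degree_in F v); exact: has_degree_covers. Qed.

Lemma has_degree_fun v m n : has_degree v m -> has_degree v n -> m = n.
Proof.
rewrite /has_degree => vm vn; apply/card_eq_II.
exact: card_eq_trans (card_esym vm) vn.
Qed.

(** Covering v by a finite list of edges expresses that v has finite degree, so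
    vertices of infinite degree are unconstrained; x itself has odd or infinite
    degree. *)
Definition only_odd_at x := forall v F, uniq F -> covers F v ->
  odd (degree_in F v) = (v == x).

Lemma odd_degree_covers v F : uniq F -> covers F v ->
  odd_degree v <-> odd (degree_in F v).
Proof.
move=> uF cF; have d := has_degree_covers uF cF.
split=> [[n on vn]|od]; last by exists (degree_in F v).
by rewrite (has_degree_fun d vn).
Qed.

(** E1 leaves two cases.  If there is a unique odd vertex, [only_odd_at x] forces
    it to be x; if there is none, x cannot have finite degree, as that degree
    would be odd. *)
Lemma distinguished_only_odd_at x : E1 G -> distinguished x <-> only_odd_at x.
Proof.
move=> hG; split.
  case=> [[[u [ou uu]] ox] v F uF cF|[nodd infx] v F uF cF].
    have [vx|vx] := eqVneq v x; first by rewrite vx in cF *; apply/odd_degree_covers.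
    apply/negP => /(odd_degree_covers uF cF) ov.
    by move/eqP: vx; apply; rewrite -(uu _ ov) (uu _ ox).
  have -> : (v == x) = false.
    by apply/eqP => vx; apply: infx; rewrite -vx; exact: covers_finite_degree cF.
  by apply/negP => /(odd_degree_covers uF cF); apply: nodd.
move=> H; case: (E1_degrees hG) => [|[_ nodd]].
  move=> exu; left; split=> //; case: exu => u [[n on un] uu].
  have [|F uF cF] := @finite_degree_covers u; first by exists n.
  have : odd (degree_in F u) by apply/odd_degree_covers => //; exists n.
  by rewrite (H _ _ uF cF) => /eqP<-; exists n.
right; split=> // /finite_degree_covers[F uF cF].
by apply: (nodd x); apply/(odd_degree_covers uF cF); rewrite (H _ _ uF cF).
Qed.

End Degrees.

(** * Covering a finite set of edges by a trail *)

Section Covering.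
Variable G : graph.
Implicit Types (e f g : edge G) (x y z v w u : vertex G).
Implicit Types (p q r s : seq (edge G * vertex G)) (F A : seq (edge G)).
Implicit Types (B : set (edge G)).

(** Walk along unused edges of A for as long as possible: the trail stops at a
    vertex z where every edge of A has been used. *)
Lemma greedy_trail A x : uniq A -> exists r z,
  [/\ walk x r z, uniq (edges r), {subset edges r <= A},
      forall e, e \in A -> incident e z -> e \in edges r &
      (exists2 e, e \in A & incident e x) -> r <> [::]].
Proof.
have [n] := ubnP (size A); elim: n A x => // n IH A x szA uA.
have [[e eA ex]|none] := pselect (exists2 e, e \in A & incident e x); last first.
  by exists [::], x; split=> // e eA ex; case: none; exists e.
have [y j] := incident_joins ex.
have [||r [z [wr ur rA rz _]]] := IH (rem e A) y; last 1 first.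
- have rA' f : f \in edges r -> (f != e) && (f \in A).
    by move=> /rA; rewrite (rem_filter _ uA) mem_filter.
  exists ((e, y) :: r), z; split=> //=.
  + by rewrite ur andbT; apply/negP => /rA'; rewrite eqxx.
  + by move=> f; rewrite inE => /orP[/eqP->|/rA'/andP[]].
  + move=> f fA fz; rewrite inE; have [->//|fe /=] := eqVneq f e.
    by apply: rz => //; rewrite (rem_filter _ uA) mem_filter /= fe.
- by rewrite size_rem //; case: A eA szA {uA}.
- exact: rem_uniq.
Qed.

(** Follow a walk from an endpoint a of an unused edge f back to u, which lies on
    s.  As long as its edges are unused edges of A, they can play the role of f;
    the closure hypothesis keeps them in A, so the first other edge is one of s,
    and the vertex just before it is on s. *)
Lemma untraversed_edge_at_trail A B s u w a f :
  (forall e e' v, e \in A -> e \notin edges s -> incident e v ->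
     B e' -> incident e' v -> e' \in A) ->
  walk u s w -> reach B a u ->
  f \in A -> f \notin edges s -> incident f a ->
  exists x g, [/\ g \in A, g \notin edges s, incident g x &
    exists s1 s2, [/\ s = s1 ++ s2, walk u s1 x & walk x s2 w]].
Proof.
move=> clos ws au; move: a au f; apply: reach_ind => [f fA fs fu|].
  by exists u, f; split=> //; exists [::], s.
move=> e a z Be j _ IH f fA fs fa.
have ea : incident e a by apply/(joins_incident _ j); left.
have [es|es] := boolP (e \in edges s).
  by exists a, f; split=> //; exact: walk_split ws es ea.
apply: IH es _; first exact: clos fA fs fa Be ea.
by apply/(joins_incident _ j); right.
Qed.

(** Euler's argument.  In the graph A' of the edges missed by s, every touched
    vertex other than w has even degree and w, if touched, has odd degree.  A
    stuck trail in A' from y to z uses all the edges of A' at z, so z = w iff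
    z <> y.  Starting at w this is absurd, so w is untouched; starting at a
    vertex x of s, the trail is closed and is inserted into s at x. *)
Lemma extend_to_cover A B s u w :
  uniq A -> walk u s w -> uniq (edges s) -> {subset edges s <= A} ->
  (forall e v, e \in A -> incident e v -> reach B v u) ->
  (forall e e' v, e \in A -> e \notin edges s -> incident e v ->
     B e' -> incident e' v -> e' \in A) ->
  (forall e v, e \in A -> e \notin edges s -> incident e v ->
     odd (degree_in A v) = (v == u)) ->
  exists s', [/\ walk u s' w, uniq (edges s') & edges s' =i A].
Proof.
move=> uA + + + Au.
have [n] := ubnP (size A - size s); elim: n s => // n IH s szs ws us sA clos par.
have [As|nAs] := boolP (all (mem (edges s)) A).
  exists s; split=> // e; apply/idP/idP => [/sA//|eA].
  exact: (allP As).
have [f fA /= fs] := allPn nAs.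
have [a [b fE]] := ends_pair f.
have fa : incident f a by rewrite /incident fE; left.
have [x [g [gA gs gx [s1 [s2 [sE w1 w2]]]]]] :=
  untraversed_edge_at_trail clos ws (Au _ _ fA fa) fA fs fa.
pose A' := [seq e <- A | e \notin edges s].
have A'P e : (e \in A') = (e \notin edges s) && (e \in A) by rewrite mem_filter.
have uA' : uniq A' by exact: filter_uniq.
have odd_rest v e : e \in A' -> incident e v -> odd (degree_in A' v) = (v == w).
  rewrite A'P => /andP[es eA] ev.
  have : degree_in A v = degree_in (edges s ++ A') v.
    apply: degree_in_sub => //.
    - rewrite cat_uniq us uA' andbT; apply/hasPn => e' /=.
      by rewrite A'P => /andP[].
    - by move=> e'; rewrite mem_cat A'P => /orP[/sA|/andP[]].
    - by move=> e' e'A _; rewrite mem_cat A'P e'A andbT orbN.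
  move/(congr1 odd); rewrite degree_in_cat oddD (odd_degree_walk v ws).
  rewrite (par e v eA es ev).
  by case: (v == u) (v == w) (odd _) => [] [] [].
have stuck y r z : walk y r z -> uniq (edges r) -> {subset edges r <= A'} ->
    (forall e, e \in A' -> incident e z -> e \in edges r) -> r <> [::] ->
    (z == w) = (z == y) (+) true.
  move=> wr ur rA rz r0; have [e er ez] := walk_last_incident wr r0.
  rewrite -(odd_rest _ _ (rA _ er) ez) (degree_in_sub uA' ur rA rz).
  by rewrite (odd_degree_walk z wr) eqxx.
have w_free e : e \in A' -> ~ incident e w.
  move=> eA' ew; have [r [z [wr ur rA rz r0]]] := greedy_trail w uA'.
  have := stuck _ _ _ wr ur rA rz (r0 (ex_intro2 _ _ e eA' ew)).
  by case: (z == w).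
have gA' : g \in A' by rewrite A'P gs.
have [r [z [wr ur rA rz r0]]] := greedy_trail x uA'.
have {}r0 := r0 (ex_intro2 _ _ g gA' gx).
have := stuck _ _ _ wr ur rA rz r0.
have [e er ez] := walk_last_incident wr r0.
have [zw _|_ H] := eqVneq z w.
  by case: (w_free e (rA _ er)); rewrite -zw.
have /eqP zx : z == x by case: (z == x) H.
subst z.
have us' : uniq (edges (s1 ++ r ++ s2)).
  have -> : uniq (edges (s1 ++ r ++ s2)) = uniq (edges s ++ edges r).
    by apply: perm_uniq; rewrite sE !edges_cat -catA perm_cat2l perm_catC.
  rewrite cat_uniq us ur andbT; apply/hasPn => e' /rA /=.
  by rewrite A'P => /andP[].
have mem' e' : (e' \in edges (s1 ++ r ++ s2)) = (e' \in edges s) || (e' \in edges r).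
  by rewrite sE !edges_cat !mem_cat orbCA [RHS]orbC.
have notin' e' : e' \notin edges (s1 ++ r ++ s2) -> e' \notin edges s.
  by rewrite mem' negb_or => /andP[].
have sA' : {subset edges (s1 ++ r ++ s2) <= A}.
  by move=> e'; rewrite mem' => /orP[/sA//|/rA]; rewrite A'P => /andP[].
apply: (IH (s1 ++ r ++ s2)).
- have r1 : 0 < size r by rewrite lt0n size_eq0; apply/eqP.
  have : size (edges (s1 ++ r ++ s2)) <= size A by exact: uniq_leq_size.
  move: szs; rewrite sE !size_map !size_cat; lia.
- exact: walk_cat w1 (walk_cat wr w2).
- by [].
- by [].
- by move=> e' e'' v e'A /notin'; apply: clos.
- by move=> e' v e'A /notin'; apply: par.
Qed.

End Covering.

(** * Walks as homomorphisms from segments *)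

Section Segments.
Local Open Scope ring_scope.

Lemma segment_ends (a b : int) (c : edge (segment a b)) :
  exists c0 c1 : vertex (segment a b),
    [/\ val c0 = val c, val c1 = val c + 1 & joins c c0 c1].
Proof.
case: c => c hc; have /andP[ac cb] := hc.
have h0 : a <= c <= b by rewrite ac ltW.
have h1 : a <= c + 1 <= b by rewrite lezD1 cb andbT (le_trans ac) // lerDl.
exists (exist _ c h0), (exist _ (c + 1) h1); split=> //.
apply/seteqP; split => v /=.
  by case=> hv; [left | right]; apply: val_inj.
by case=> ->; [left | right].
Qed.

Variable G : graph.
Implicit Types (x y z : vertex G) (p r : seq (edge G * vertex G)).

(** The vertex reached after k steps. *)
Definition nth_vertex (x : vertex G) p k := nth x (x :: [seq h.2 | h <- p]) k.

Lemma nth_vertex_size x p y : walk x p y -> nth_vertex x p (size p) = y.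
Proof.
rewrite /nth_vertex; suff E z : walk z p y ->
    nth x (z :: [seq h.2 | h <- p]) (size p) = y.
  exact: E.
by elim: p z => [|[e z'] p IH] z //= [_ /IH].
Qed.

Lemma joins_nth_vertex x p y k e0 : walk x p y -> (k < size p)%N ->
  joins (nth e0 (edges p) k) (nth_vertex x p k) (nth_vertex x p k.+1).
Proof.
rewrite /nth_vertex => wp kp.
suff E z : walk z p y ->
    joins (nth e0 (edges p) k) (nth x (z :: [seq h.2 | h <- p]) k)
      (nth x (z :: [seq h.2 | h <- p]) k.+1) by exact: E.
elim: p z k {wp} kp => [|[e z'] p IH] z [|k] //= kp [j wp] //.
exact: (IH z' k).
Qed.

Lemma nth_vertex_cat x p r k : (k <= size p)%N ->
  nth_vertex x (p ++ r) k = nth_vertex x p k.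
Proof.
by case: k => //= k kp; rewrite /nth_vertex /= map_cat nth_cat size_map kp.
Qed.

Lemma hom_joins (P : graph) (t : Defs.hom P G) (e : edge P) (x y : vertex P) :
  joins e x y -> joins (hom_edge t e) (t x) (t y).
Proof. by rewrite /joins hom_ends => ->; rewrite image_setU !image_set1. Qed.

(** The clauses on indices determine the whole path t from the list p: its
    vertices and edges are the entries of p, shifted by a. *)
Lemma gpath_walk (a b : int) (ab : a <= b) (t : Defs.hom (segment a b) G) :
  exists p, [/\ walk (t (segment_fst ab)) p (t (segment_lst ab)),
    a + (size p)%:Z = b,
    forall k (c : vertex (segment a b)), val c = a + k%:Z ->
       nth_vertex (t (segment_fst ab)) p k = t c &
    forall k (c : edge (segment a b)), val c = a + k%:Z ->
       forall d, nth d (edges p) k = hom_edge t c].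
Proof.
set x := t (segment_fst ab).
(* induction on the length m of the initial part of t that is read off *)
have H (m : nat) (z : vertex (segment a b)) : val z = a + m%:Z ->
  exists p, [/\ walk x p (t z), size p = m,
    forall k (c : vertex (segment a b)), (k <= m)%N -> val c = a + k%:Z ->
       nth_vertex x p k = t c &
    forall k (c : edge (segment a b)), (k < m)%N -> val c = a + k%:Z ->
       forall d, nth d (edges p) k = hom_edge t c].
  elim: m z => [|m IH] z zE.
    exists [::]; split=> //.
      by congr (hom_vertex _ _); apply: val_inj; rewrite zE addr0.
    move=> k c; rewrite leqn0 => /eqP-> cE.
    by congr (hom_vertex _ _); apply: val_inj; rewrite cE addr0.
  have /andP[az zb] := valP z.
  have h : a <= a + m%:Z < b by rewrite lerDl /=; move: zb; rewrite zE; lia.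
  pose c : edge (segment a b) := exist _ (a + m%:Z) h.
  have [c0 [c1 [c0E c1E j]]] := segment_ends c.
  have [p [wp sp vp ep]] := IH c0 c0E.
  have c1z : c1 = z by apply: val_inj; rewrite c1E zE /=; lia.
  rewrite -{}c1z in zE *.
  exists (rcons p (hom_edge t c, t c1)); split.
  - rewrite -cats1; apply: walk_cat wp _; split=> //; exact: hom_joins.
  - by rewrite size_rcons sp.
  - move=> k c'; rewrite leq_eqVlt => /orP[/eqP->|]; last first.
      by rewrite ltnS => km c'E; rewrite -cats1 nth_vertex_cat ?sp // (vp _ _ km c'E).
    move=> c'E; rewrite /nth_vertex /= map_rcons nth_rcons size_map sp ltnn eqxx /=.
    by congr (hom_vertex _ _); apply: val_inj; rewrite c'E -zE.
  - move=> k c' km c'E d; rewrite /edges map_rcons nth_rcons size_map sp.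
    move: km; rewrite ltnS leq_eqVlt => /orP[/eqP km|km]; last first.
      by rewrite km; apply: ep.
    rewrite km ltnn eqxx; congr (hom_edge _ _); apply: val_inj.
    by rewrite c'E km.
have [|p [wp sp vp ep]] := H `|b - a|%N (segment_lst ab).
  by rewrite /=; lia.
exists p; split=> //; first by lia.
  by move=> k c cE; apply: vp => //; have /andP[] := valP c; rewrite cE; lia.
by move=> k c cE; apply: ep => //; have /andP[] := valP c; rewrite cE; lia.
Qed.

Lemma walk_gpath x p y : walk x p y -> uniq (edges p) ->
  exists (hb : 0 <= (size p)%:Z) (t : gpath (segment 0 (size p)%:Z) G),
    initial_vertex hb t = x /\ final_vertex hb t = y.
Proof.
move=> wp up.
pose fv (c : vertex (segment 0 (size p)%:Z)) := nth_vertex x p `|val c|%N.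
have kE (c : edge (segment 0 (size p)%:Z)) : (`|val c| < size p)%N.
  by have /andP[] := valP c; lia.
have /choice[fe feE] (c : edge (segment 0 (size p)%:Z)) :
    exists e : edge G, forall d, e = nth d (edges p) `|val c|%N.
  case: p wp up kE {fv} c => [|[e z] p] wp up kE c; first by have := kE c.
  exists (nth e (edges ((e, z) :: p)) `|val c|%N) => d.
  by apply: set_nth_default; rewrite size_map.
have homE (c : edge (segment 0 (size p)%:Z)) : ends (fe c) = fv @` ends c.
  have [c0 [c1 [c0E c1E j]]] := segment_ends c.
  rewrite j image_setU !image_set1 /fv c0E c1E (feE c (fe c)).
  have /andP[c_ge0 _] := valP c.
  have -> : `|(val c + 1)%R|%N = `|val c|.+1%N by lia.
  exact: (joins_nth_vertex _ wp (kE c)).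
have inj : injective (hom_edge (Defs.Hom homE)).
  move=> c c' /= E; apply: val_inj.
  have /andP[c0 _] := valP c; have /andP[c0' _] := valP c'.
  have /eqP : nth (fe c) (edges p) `|val c|%N = nth (fe c) (edges p) `|val c'|%N.
    by rewrite -feE -feE.
  rewrite nth_uniq ?size_map //; lia.
have hb : 0 <= (size p)%:Z by [].
exists hb, (GPath inj); split; rewrite /initial_vertex /final_vertex /= /fv //=.
exact: nth_vertex_size wp.
Qed.

(** Paths repeat no edge while walks may, hence the passage to a trail. *)
Lemma connectedP : connected G <-> forall x y, reach setT x y.
Proof.
split=> H x y.
  have [a [b [ab [t [<- <-]]]]] := H x y.
  by have [p [wp _ _ _]] := gpath_walk ab t; exists p.
have [p wp _] := H x y; have [q [wq uq _]] := walk_trail wp.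
by have [hb [t E]] := walk_gpath wq uq; exists 0, (size q)%:Z, hb, t.
Qed.

End Segments.

(** * Connectedness of subgraphs *)

Section Subgraphs.
Variables (G : graph).

Lemma joins_sub (H : subgraph G) (e : edge H) (x y : vertex H) :
  joins e x y <-> joins (val e) (val x) (val y).
Proof.
rewrite /joins /=; split=> E; last first.
  apply/seteqP; split=> v /=; rewrite E.
    by case=> /val_inj; [left|right].
  by case=> ->; [left|right].
have vE (v : vertex H) : ends (val e) (val v) <-> v = x \/ v = y.
  by have := congr1 (@^~ v) E => /= ->.
apply/seteqP; split=> v /=.
  move=> ev; have vH : subV H v by exact: sub_closed (set_mem (valP e)) _ ev.
  by have /vE[<-|<-] : ends (val e) (val (SigSub (mem_set vH))) by []; [left|right].
by case=> ->; apply/vE; [left|right].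
Qed.

Lemma reach_val (H : subgraph G) (x y : vertex H) :
  reach setT x y -> reach (subE H) (val x) (val y).
Proof.
move: x; apply: reach_ind; first exact: reach_refl.
move=> e x z _ /joins_sub j _; apply: reach_trans.
apply: (reach_edge (set_mem (valP e))); apply/(joins_incident _ j);
  by [left|right].
Qed.

(** A walk of G which starts in H and uses edges of H stays in H; the set A
    remembers which edges are used. *)
Lemma reach_lift (H : subgraph G) (A : set (edge G)) (x y : vertex H) :
  A `<=` subE H -> reach A (val x) (val y) ->
  reach [set e : edge H | A (val e)] x y.
Proof.
move=> AH; move: {-1}(val x) (erefl (val x)) => x' + r; move: x' r x.
apply: reach_ind => [x /val_inj->|e x z Ae j _ IH x0 xE]; first exact: reach_refl.
have zH : subV H z by apply: sub_closed (AH _ Ae) _ _; rewrite j; right.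
apply: reach_trans (IH (SigSub (mem_set zH)) erefl).
pose e' : edge H := SigSub (mem_set (AH _ Ae)).
have e'x : incident e' x0 by rewrite /incident /= xE j; left.
have e'z : incident e' (SigSub (mem_set zH) : vertex H).
  by rewrite /incident /= j; right.
exact: reach_edge e'x e'z.
Qed.

Lemma connected_subP (H : subgraph G) : connected H <->
  forall x y, subV H x -> subV H y -> reach (subE H) x y.
Proof.
split=> [/connectedP H1 x y Hx Hy|H1].
  exact: (reach_val (H1 (SigSub (mem_set Hx)) (SigSub (mem_set Hy)))).
apply/connectedP => x y; apply: (reach_sub (@subsetT _ _)).
apply: (reach_lift (A := subE H)) => //; apply: H1; exact: set_mem (valP _).
Qed.

End Subgraphs.

Lemma card_le_I1_eq (T : Type) (X : set T) (a b : T) :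
  X #<= `I_1 -> X a -> X b -> a = b.
Proof.
move=> /pcard_leP[f] Xa Xb.
apply: (@inj _ _ _ f); rewrite ?inE //.
have : `I_1 (f a) by exact: funS.
have : `I_1 (f b) by exact: funS.
by move=> /=; case: (f a) (f b) => [|?] [|?].
Qed.

(** * Using the single end *)

Section OneEnd.
Variable G : graph.
Implicit Types (e f g : edge G) (x y z v w u : vertex G) (F : seq (edge G)).
Implicit Types (p q r s : seq (edge G * vertex G)).

Definition off F : set (edge G) := ~` [set` F].

Lemma offP F e : off F e <-> e \notin F.
Proof. by split=> /negP. Qed.

(** Vertices all of whose edges are in F disappear with F, so only the vertices
    that keep an edge are compared. *)
Definition connected_off F := forall x y e f,
  off F e -> incident e x -> off F f -> incident f y -> reach (off F) x y.

Lemma connected_offP F : connected (del_edges [set` F]) <-> connected_off F.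
Proof.
split=> [/connected_subP H x y e f oe ex nf fy|H].
  by apply: H; [exists e|exists f].
by apply/connected_subP => x y [e oe ex] [f nf fy]; exact: H oe ex nf fy.
Qed.

Section Classes.
Variable F : seq (edge G).

(** These are the edges of the component of y in G - F; the set is empty if y
    loses all its edges. *)
Definition class_off y : set (edge G) :=
  [set e | off F e /\ exists2 v, incident e v & reach (off F) y v].

Lemma class_off_incident y e v : class_off y e -> incident e v ->
  reach (off F) y v.
Proof. by move=> [oe [z ez yz]] ev; apply: reach_trans yz (reach_edge oe ez ev). Qed.

Lemma reach_class_off y x z : reach (off F) y x -> reach (off F) x z ->
  reach (class_off y) x z.
Proof.
move=> + r; move: x r; apply: reach_ind => [_|e x v oe j _ IH yx].
  exact: reach_refl.
have ex : incident e x by apply/(joins_incident _ j); left.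
have ev : incident e v by apply/(joins_incident _ j); right.
apply: (reach_trans (y := v)).
  by apply: (reach_edge _ ex ev); split=> //; exists x.
exact: IH (reach_trans yx (reach_edge oe ex ev)).
Qed.

Lemma class_off_graph_closed y (e : edge (del_edges [set` F])) :
  class_off y (val e) -> ends e `<=`
    [set v : vertex (del_edges [set` F]) | reach (off F) y (val v)].
Proof. by move=> ye v ev; exact: class_off_incident ye ev. Qed.

Definition class_off_graph y : subgraph (del_edges [set` F]) :=
  Subgraph (@class_off_graph_closed y).

Lemma class_off_graph_infinite y : infinite_set (class_off y) ->
  infinite_graph (class_off_graph y).
Proof.
move=> infy fin; apply: infy.
pose f (e : edge (class_off_graph y)) : edge G :=
  val (val e : edge (del_edges [set` F])).
apply: sub_finite_set (finite_image f fin) => e ye.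
pose e1 : edge (del_edges [set` F]) := SigSub (mem_set (proj1 ye)).
by exists (SigSub (mem_set (ye : subE (class_off_graph y) e1))).
Qed.

(** A connected subgraph of G - F containing this one has only vertices
    reachable from y, hence only edges of the class of y. *)
Lemma class_off_graph_component y : infinite_set (class_off y) ->
  component (class_off_graph y).
Proof.
move=> infy; split.
  apply/connected_subP => x z /= yx yz.
  apply: reach_lift => [e []//|]; apply: reach_class_off => //.
  exact: reach_trans (reach_sym yx) yz.
move=> D /connected_subP connD [VD ED].
have [e ye] := infinite_setN0 infy.
have [v ev yv] := proj2 ye.
pose v0 : vertex (del_edges [set` F]) :=
  SigSub (mem_set (ex_intro2 _ _ e (proj1 ye) ev)).
have Dv d : subV D d -> reach (off F) y (val d).
  move=> Dd; apply: (reach_trans yv).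
  have /reach_val := reach_sub (@subsetT _ _) (connD v0 d (VD v0 yv) Dd).
  by [].
split=> [d /Dv//|e' De'].
have [a [b E]] := ends_pair e'.
have e'a : ends e' a by rewrite E; left.
split; first exact: set_mem (valP e').
by exists (val a) => //; apply: Dv; exact: sub_closed De' _ e'a.
Qed.

End Classes.

(** The bound on the number of ends counts components as subgraphs, so two
    infinite components are equal, and they share every vertex of either. *)
Lemma one_infinite_class F y y' : ends_bound G 1 ->
  infinite_set (class_off F y) -> infinite_set (class_off F y') ->
  reach (off F) y y'.
Proof.
move=> /(_ [set` F] (finite_seq _)) oneF infy infy'.
have E : class_off_graph F y = class_off_graph F y'.
  apply: card_le_I1_eq oneF _ _;
  split; by [exact: class_off_graph_component|exact: class_off_graph_infinite].
have [e ye] := infinite_setN0 infy.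
have [v ev yv] := proj2 ye.
pose v0 : vertex (del_edges [set` F]) :=
  SigSub (mem_set (ex_intro2 _ _ e (proj1 ye) ev)).
have : subV (class_off_graph F y) v0 by [].
by rewrite E => /reach_sym; apply: reach_trans.
Qed.

Lemma endpoints F : exists R : seq (vertex G),
  forall e v, e \in F -> incident e v -> v \in R.
Proof.
elim: F => [|e F [R RP]]; first by exists [::].
have [x [y E]] := ends_pair e; exists [:: x, y & R] => f v.
rewrite inE => /orP[/eqP->|fF fv]; last by rewrite !inE (RP f) ?orbT.
by rewrite /incident E => -[]->; rewrite !inE eqxx ?orbT.
Qed.

(** F' adds to F the edges of all finite components of G - F.  Every component
    of G - F contains the fixed vertex v0 or an endpoint of an edge of F: a walk
    to v0 either avoids F or meets such an endpoint.  So there are finitely many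
    components and F' is finite.  The edges outside F' form the only infinite
    component, and an edge of F' - F cannot share a vertex with them. *)
Lemma absorb_finite_components F : connected G -> ends_bound G 1 ->
  infinite_graph G ->
  exists F', [/\ uniq F', {subset F <= F'}, connected_off F' &
    forall e e' v, e \in F' -> off F e -> incident e v -> incident e' v ->
      e' \in F'].
Proof.
move=> /connectedP conn one inf.
have [e0 _] := infinite_setN0 inf.
have [v0 [_ _]] := ends_pair e0.
have [R RP] := endpoints F.
have to_root x : exists2 y, y \in v0 :: R & reach (off F) y x.
  move: x (conn x v0); apply: reach_ind.
    by exists v0; [rewrite inE eqxx|exact: reach_refl].
  move=> e x z _ j _ [y yR yz].
  have ex : incident e x by apply/(joins_incident _ j); left.
  have [eF|/offP oe] := boolP (e \in F).
    by exists x; [rewrite inE (RP e) ?orbT|exact: reach_refl].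
  exists y => //; apply: reach_trans yz (reach_edge oe _ ex).
  by apply/(joins_incident _ j); right.
pose small := [set y | y \in v0 :: R /\ finite_set (class_off F y)].
have /finite_seqP[F'' F''E] :
    finite_set ([set` F] `|` \bigcup_(y in small) class_off F y).
  rewrite finite_setU; split; first exact: finite_seq.
  apply: bigcup_finite => [|y []//].
  by apply: sub_finite_set (finite_seq (v0 :: R)) => y [].
pose F' := undup F''.
have F'P e : e \in F' <-> e \in F \/ exists2 y, small y & class_off F y e.
  rewrite mem_undup; split=> H.
    by have : [set` F''] e by []; rewrite -F''E.
  by have : [set` F''] e by rewrite -F''E.
have big y e : class_off F y e -> e \notin F' -> infinite_set (class_off F y).
  move=> [oe [v ev yv]] /negP eF' finy; apply: eF'; apply/F'P; right.
  have [y' y'R y'v] := to_root v; exists y'; last by split=> //; exists v.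
  split=> //; apply: sub_finite_set finy => f [nf [z fz y'z]]; split=> //.
  exists z => //; apply: reach_trans yv (reach_trans (reach_sym y'v) y'z).
have offF e : off F' e -> off F e.
  by move=> /offP eF'; apply/offP; apply: contra eF' => eF; apply/F'P; left.
exists F'; split.
- exact: undup_uniq.
- by move=> e eF; apply/F'P; left.
- move=> x z e f oe ex nf fz.
  have infx : infinite_set (class_off F x).
    apply: (big x e); last exact/offP.
    by split; [exact: offF|exists x => //; exact: reach_refl].
  have infz : infinite_set (class_off F z).
    apply: (big z f); last exact/offP.
    by split; [exact: offF|exists z => //; exact: reach_refl].
  have xz := one_infinite_class one infx infz.
  apply: reach_sub (reach_class_off (reach_refl _ _) xz) => g xg.
  apply/offP/negP => /F'P[|[y [_ finy] yg]]; first by apply/negP/offP; case: xg.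
  apply: infx; apply: sub_finite_set finy => h [oh [v hv xv]].
  split=> //; exists v => //; have [og [a ga ya]] := yg.
  by apply: reach_trans ya (reach_trans (reach_sym (class_off_incident xg ga)) xv).
- move=> e e' v /F'P[eF|[y sy ye]] oe ev e'v; first by move/offP: oe; rewrite eF.
  apply/F'P; have [|/offP oe'] := boolP (e' \in F); first by left.
  right; exists y => //; split=> //; exists v => //.
  exact: class_off_incident ye ev.
Qed.

Hypothesis hG : E1 G.

(** If all the edges at the end w of the trail were used, the degree of w
    would be even for w = x0 and odd otherwise, against the property of x0. *)
Lemma odd_degree_escapes x0 p w : only_odd_at x0 -> walk x0 p w ->
  uniq (edges p) -> exists2 e, off (edges p) e & incident e w.
Proof.
move=> odd0 wp up; apply: contrapT => none.
have : covers (edges p) w.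
  by move=> e ew; apply: contrapT => /negP/offP oe; apply: none; exists e.
move=> /(odd0 w _ up); rewrite (odd_degree_walk w wp) eqxx addbT.
by case: (w == x0).
Qed.

(** The new piece r covers e, all edges of a trail p of G - q through e, and the
    finite components of G - q - p. *)
Lemma extend_trail x0 q u e :
  only_odd_at x0 -> walk x0 q u -> uniq (edges q) -> connected_off (edges q) ->
  off (edges q) e ->
  exists r w, [/\ walk u r w, uniq (edges (q ++ r)),
    connected_off (edges (q ++ r)) & e \in edges r].
Proof.
move=> odd0 wq uq connq oe.
have [e1 oe1 e1u] := odd_degree_escapes odd0 wq uq.
have from_u f v : off (edges q) f -> incident f v -> reach (off (edges q)) v u.
  by move=> nf fv; apply: connq nf fv oe1 e1u.
have [p [w [wp up pq ep]]] : exists p w,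
    [/\ walk u p w, uniq (edges p), forall f, f \in edges p -> off (edges q) f &
        e \in edges p].
  have [a [b E]] := ends_pair e.
  have ea : incident e a by rewrite /incident E; left.
  have [p0 /walk_trail[p [wp up pp0]] p0q] := reach_sym (from_u _ _ oe ea).
  have pq f : f \in edges p -> off (edges q) f by move=> /pp0/p0q.
  have [ep|ep] := boolP (e \in edges p); first by exists p, a.
  exists (p ++ [:: (e, b)]), b; rewrite !edges_cat; split.
  - exact: walk_cat wp _.
  - by rewrite cat_uniq up /= orbF ep.
  - by move=> f; rewrite mem_cat inE => /orP[/pq//|/eqP->].
  - by rewrite mem_cat inE eqxx orbT.
have uqp : uniq (edges q ++ edges p).
  by rewrite cat_uniq uq up andbT; apply/hasPn => f /pq/offP.
have [F' [uF' F'qp connF' sep]] := absorb_finite_components (edges q ++ edges p)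
  (E1_connected hG) (proj1 (E1_ends hG)) (E1_infinite hG).
pose A := [seq f <- F' | f \notin edges q].
have AP f : (f \in A) = (f \notin edges q) && (f \in F') by rewrite mem_filter.
have uA : uniq A by exact: filter_uniq.
have pA : {subset edges p <= A}.
  move=> f fp; rewrite AP F'qp ?mem_cat ?fp ?orbT // andbT.
  exact/offP/pq.
(* an edge of A outside p comes from a finite component of G - q - p *)
have new f v : f \in A -> f \notin edges p -> incident f v -> covers F' v.
  rewrite AP => /andP[fq fF'] fp fv g gv; apply: (sep f g v) => //.
  by apply/offP; rewrite mem_cat negb_or fq.
have [|||s [ws us sE]] := extend_to_cover (B := off (edges q)) uA wp up pA.
- by move=> f v; rewrite AP => /andP[/offP nf _]; exact: from_u.
- move=> f g v fA fp fv /offP og gv; rewrite AP og.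
  exact: new fA fp fv _ gv.
- move=> f v fA fp fv; have cF' := new f v fA fp fv.
  have : degree_in F' v = degree_in (edges q ++ A) v.
    apply: degree_in_sub => //.
    + rewrite cat_uniq uq uA andbT; apply/hasPn => g.
      by rewrite AP => /andP[].
    + move=> g; rewrite mem_cat AP => /orP[gq|/andP[]//].
      by rewrite F'qp // mem_cat gq.
    + by move=> g gF' _; rewrite mem_cat AP gF' andbT orbN.
  move/(congr1 odd); rewrite degree_in_cat oddD (odd_degree_walk v wq).
  rewrite (odd0 v F' uF' cF').
  by case: (v == x0) (v == u) (odd _) => [] [] [].
have qsE : edges (q ++ s) =i F'.
  move=> f; rewrite edges_cat mem_cat sE AP.
  by case: (boolP (f \in edges q)) => // fq; rewrite F'qp // mem_cat fq.
exists s, w; split=> //.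
- rewrite edges_cat cat_uniq uq us andbT; apply/hasPn => f.
  by rewrite sE AP => /andP[].
- have -> : connected_off (edges (q ++ s)) = connected_off F'; last by [].
  rewrite /connected_off; suff -> : off (edges (q ++ s)) = off F' by [].
  by apply/funext => f; rewrite /off /= /setC /= qsE.
- by rewrite sE pA.
Qed.

End OneEnd.

(** * Eulerian rays *)

Section Rays.
Variable G : graph.
Implicit Types (e f g : edge G) (x y z v w u : vertex G) (F : seq (edge G)).
Implicit Types (p q r s : seq (edge G * vertex G)).

Lemma ray_joins (T : gpath ray G) k : joins (hom_edge T k) (T k) (T k.+1).
Proof. exact: (@hom_joins G ray T k k k.+1 erefl). Qed.

(** The limit of a strictly growing sequence of trails.  As s n has at least n
    edges, the edge k of the ray can be read off s (k + 1). *)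
Lemma ray_of_trails x0 (s : nat -> seq (edge G * vertex G)) :
  (forall n, exists u, walk x0 (s n) u) -> (forall n, uniq (edges (s n))) ->
  (forall n, exists2 r, r <> [::] & s n.+1 = s n ++ r) ->
  exists T : gpath ray G, forall n k,
    (k <= size (s n) -> T k = nth_vertex x0 (s n) k) /\
    (k < size (s n) -> forall d, hom_edge T k = nth d (edges (s n)) k).
Proof.
move=> ws us ss.
have s_ge n : n <= size (s n).
  elim: n => // n IH; have [r r0 ->] := ss n; rewrite size_cat.
  have : 0 < size r by rewrite lt0n size_eq0; apply/eqP.
  lia.
have s_pre m n : m <= n -> exists r, s n = s m ++ r.
  elim: n => [|n IH]; first by rewrite leqn0 => /eqP->; exists [::]; rewrite cats0.
  rewrite leq_eqVlt => /orP[/eqP->|/IH[r E]]; first by exists [::]; rewrite cats0.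
  by have [r' _ ->] := ss n; exists (r ++ r'); rewrite E catA.
have vertexE m n k : k <= size (s m) -> k <= size (s n) ->
    nth_vertex x0 (s m) k = nth_vertex x0 (s n) k.
  by have [/s_pre[r ->] ? ?|/ltnW/s_pre[r ->] ? ?] := leqP m n; rewrite nth_vertex_cat.
have nthE m n k d d' : k < size (s m) -> k < size (s n) ->
    nth d (edges (s m)) k = nth d' (edges (s n)) k.
  have [/s_pre[r ->] km ?|/ltnW/s_pre[r ->] ? kn] := leqP m n.
    by rewrite edges_cat nth_cat size_map km; apply: set_nth_default; rewrite size_map.
  by rewrite edges_cat nth_cat size_map kn; apply: set_nth_default; rewrite size_map.
have /choice[fe feE] (k : nat) : exists e : edge G, forall d,
    e = nth d (edges (s k.+1)) k.
  have ks := s_ge k.+1; case E : (s k.+1) ks => [|[e z] p] // ks.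
  exists (nth e (edges ((e, z) :: p)) k) => d.
  by apply: set_nth_default; rewrite size_map.
pose fv (k : nat) := nth_vertex x0 (s k) k.
have homE (k : edge ray) : ends (fe k) = fv @` ends k.
  have [u wu] := ws k.+1; rewrite image_setU !image_set1 (feE k (fe k)).
  rewrite /fv (vertexE k k.+1) //; last by apply: ltnW; exact: s_ge k.+1.
  exact: (joins_nth_vertex _ wu (s_ge k.+1)).
have inj : injective (hom_edge (Defs.Hom homE)).
  move=> k k' /= E; pose n := (maxn k k').+1.
  have kn : k < size (s n) by apply: leq_trans (s_ge n); rewrite ltnS leq_maxl.
  have kn' : k' < size (s n) by apply: leq_trans (s_ge n); rewrite ltnS leq_maxr.
  have /eqP : nth (fe k) (edges (s n)) k = nth (fe k) (edges (s n)) k'.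
    rewrite (nthE n k.+1 k (fe k) (fe k) kn (s_ge _)).
    rewrite (nthE n k'.+1 k' (fe k) (fe k) kn' (s_ge _)).
    by rewrite -!feE.
  by rewrite nth_uniq ?size_map // => /eqP.
exists (GPath inj) => n k; split=> [kn|kn d] /=.
  exact: vertexE.
by rewrite (feE k d); apply: nthE => //; exact: s_ge.
Qed.

(** Step n of the construction takes care of the n-th edge of an enumeration.
    If that edge is already visited, another unvisited edge is used instead, so
    that the trails grow strictly. *)
Lemma eulerian_ray x0 q u : E1 G -> only_odd_at x0 -> walk x0 q u ->
  uniq (edges q) -> connected_off (edges q) ->
  exists T : gpath ray G, [/\ eulerian T,
    forall k, k <= size q -> T k = nth_vertex x0 q k &
    forall k d, k < size q -> hom_edge T k = nth d (edges q) k].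
Proof.
move=> hG odd0 wq uq cq.
pose good p := [/\ exists w, walk x0 p w, uniq (edges p) & connected_off (edges p)].
have /choice[next nextP] (h : seq (edge G * vertex G) * edge G) : exists r,
    good h.1 -> [/\ r <> [::], good (h.1 ++ r) & h.2 \in edges (h.1 ++ r)].
  case: h => p e /=; have [gp|ngp] := pselect (good p); last by exists [::].
  have [[w wp] up cp] := gp.
  have [f nf ef] : exists2 f, off (edges p) f & e = f \/ e \in edges p.
    have [ep|/offP] := boolP (e \in edges p); last by exists e; [|left].
    have [f nf _] := odd_degree_escapes odd0 wp up.
    by exists f => //; right.
  have [r [w' [wr ur cr fr]]] := extend_trail hG odd0 wp up cp nf.
  exists r => _; split.
  - by move=> r0; rewrite r0 in fr.
  - by split=> //; exists w'; exact: walk_cat wp wr.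
  - by rewrite edges_cat mem_cat; case: ef => [->|->//]; rewrite fr orbT.
have /pcard_leTP[code] := E1_countable hG.
have [e0 _] := infinite_setN0 (E1_infinite hG).
(* a left inverse of the injective numbering code of the edges *)
have /choice[enum enumP] (n : nat) : exists e, forall f, code f = n -> f = e.
  have [[e <-]|none] := pselect (exists e, code e = n).
    by exists e => f; apply: inj; rewrite inE.
  by exists e0 => f fn; case: none; exists f.
pose fix s n := if n is n'.+1 then s n' ++ next (s n', enum n') else q.
have gs n : good (s n).
  elim: n => [|n IH]; first by split=> //; exists u.
  by have [] := nextP (s n, enum n) IH.
have [|||T TP] := @ray_of_trails x0 s.
- by move=> n; case: (gs n).
- by move=> n; case: (gs n).
- move=> n; exists (next (s n, enum n)) => //.
  by have [] := nextP (s n, enum n) (gs n).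
exists T; split=> [e|k|k d kq]; last 2 first.
- by case: (TP 0 k).
- by case: (TP 0 k) => _; apply.
pose n := code e.
have en : e \in edges (s n.+1).
  have [_ _ /=] := nextP (s n, enum n) (gs n).
  by rewrite -(enumP n e erefl).
exists (index e (edges (s n.+1))).
have E : hom_edge T (index e (edges (s n.+1))) = e.
  have [_ /(_ _ e) ->] := TP n.+1 (index e (edges (s n.+1))).
    exact: nth_index.
  by rewrite -[X in _ < X](size_map fst) index_mem.
by split=> // k kE; apply: (gpath_inj (g := T)); rewrite E.
Qed.

Lemma ray_walk (T : gpath ray G) m n :
  walk (T m) [seq (hom_edge T k, T k.+1) | k <- iota m n] (T (m + n)).
Proof.
elim: n m => [|n IH] m /=; first by rewrite addn0.
by split; [exact: ray_joins | rewrite addnS -addSn].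
Qed.

(** Cut the ray at a time N after which no edge at v is used.  The initial part
    then contains all the edges at v, and it does not end at v because the next
    edge is not at v. *)
Lemma eulerian_ray_only_odd_at (T : gpath ray G) :
  eulerian T -> only_odd_at (T 0).
Proof.
move=> eT v F uF cF.
have [N NP] : exists N, forall k : nat, hom_edge T k \in F -> k < N.
  elim: F {uF cF} => [|e F [N NP]]; first by exists 0.
  have [k [kE _]] := eT e; exists (maxn k.+1 N) => l.
  rewrite inE => /orP[/eqP lE|/NP lN]; last by rewrite leq_max lN orbT.
  have -> : l = k by apply: (gpath_inj (g := T)); rewrite lE.
  by rewrite leq_maxl.
have wp := ray_walk T 0 N; set p := map _ _ in wp.
have pE : edges p = [seq hom_edge T k | k <- iota 0 N] by rewrite /edges -map_comp.
have -> : degree_in F v = degree_in (edges p) v.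
  apply/esym/degree_in_sub => //.
  - rewrite pE (@map_inj_uniq nat _ (hom_edge T)) ?iota_uniq //.
    by move=> i j /(gpath_inj (g := T)).
  - move=> e eF; have [k [kE _]] := eT e; rewrite pE -kE.
    by apply: (@map_f nat); rewrite mem_iota /= add0n; apply: NP; rewrite kE.
  - by move=> e _; apply: cF.
rewrite (odd_degree_walk v wp) add0n.
have [vN|_] := eqVneq v (T N); last by rewrite addbF.
have /cF/NP : incident (hom_edge T N) v.
  by apply/(joins_incident _ (ray_joins T N)); left.
by rewrite ltnn.
Qed.

End Rays.

Section PathEdges.
Local Open Scope ring_scope.
Variable G : graph.

Lemma gpath_trail (a b : int) (t : gpath (segment a b) G) p :
  a + (size p)%:Z = b ->
  (forall k (c : edge (segment a b)), val c = a + k%:Z ->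
    forall d, nth d (edges p) k = hom_edge t c) ->
  uniq (edges p) /\ visited_edges t = [set` edges p].
Proof.
move=> sp ep.
have at_k k : (k < size p)%N -> exists c : edge (segment a b), val c = a + k%:Z.
  move=> kp; have h : a <= a + k%:Z < b by rewrite -sp; lia.
  by exists (exist _ (a + k%:Z) h).
split.
  case: p sp ep at_k => // h p sp ep at_k; apply/(uniqP h.1) => i j.
  rewrite !inE !size_map => ip jp.
  have [ci ciE] := at_k i ip; have [cj cjE] := at_k j jp.
  rewrite (ep _ _ ciE) (ep _ _ cjE) => /gpath_inj cij.
  by move: ciE; rewrite cij cjE; lia.
apply/seteqP; split=> e /=.
  move=> [c _ <-]; have /andP[ac cb] := valP c.
  have cE : val c = a + `|val c - a|%N%:Z by lia.
  rewrite -(ep _ _ cE (hom_edge t c)); apply: mem_nth; rewrite size_map; lia.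
move=> ep'; have kp : (index e (edges p) < size p)%N.
  by rewrite -[X in (_ < X)%N](size_map fst) index_mem.
have [c cE] := at_k _ kp; exists c => //.
by rewrite -(ep _ _ cE e) nth_index.
Qed.

End PathEdges.

Theorem theorem3 (G : graph) (hG : E1 G) :
  (forall (b : int) (hb : (0 <= b)%R) (t : gpath (segment 0%R b) G),
     (exists T : gpath ray G, extends T t /\ eulerian T) <->
     [/\ connected (del_path t),
         distinguished (initial_vertex hb t) &
         exists e : edge G,
           incident e (final_vertex hb t) /\ ~ visited_edges t e]) /\
  (forall v : vertex G,
     (exists T : gpath ray G, ray_initial_vertex T = v /\ eulerian T) <->
     distinguished v).
Proof.
split=> [b hb t|v]; last first.
  split=> [[T [<- eT]]|/(distinguished_only_odd_at _ hG) odd0].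
    exact/(distinguished_only_odd_at _ hG)/eulerian_ray_only_odd_at.
  (* the trail of length 0 at v, whose complement is G itself *)
  have [||T [eT /(_ 0 erefl) T0 _]] := @eulerian_ray G v [::] v hG odd0 erefl.
  - by [].
  - move=> x y e f _ _ _ _.
    have [p wp _] := (connectedP G).1 (E1_connected hG) x y.
    by exists p.
  by exists T.
have [p [wp sp vp ep]] := gpath_walk hb t.
have [up tp] := gpath_trail sp ep.
split; last first.
  rewrite /del_path tp => -[/connected_offP cp /(distinguished_only_odd_at _ hG) odd0 _].
  have [T [eT Tv Te]] := eulerian_ray hG odd0 wp up cp.
  exists T; split=> //; split=> k c cE; have /andP[_ cb] := valP c.
    by rewrite Tv ?(vp k c) ?add0r //; move: cb cE sp => /=; lia.
  rewrite (Te _ (hom_edge t c)); last by move: cb cE sp => /=; lia.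
  by rewrite (ep k c) ?add0r.
move=> [T [[Tv Te] eT]].
case: b hb t p wp sp vp ep up tp Tv Te => // n hb t p wp sp vp ep up tp Tv Te.
have T0 : T 0 = initial_vertex hb t by exact: Tv.
have Tn : T n = final_vertex hb t by exact: Tv.
have late (k : nat) : visited_edges t (hom_edge T k) -> (k < n)%N.
  move=> [c _]; have /andP[c0 cn] := valP c.
  have cE : val c = Posz `|val c|%N by lia.
  by rewrite -(Te _ _ cE) => /gpath_inj <-; lia.
have early (k : nat) : ~ visited_edges t (hom_edge T k) -> n <= k.
  move=> nv; rewrite leqNgt; apply/negP => kn; apply: nv.
  have h : (0 <= Posz k < Posz n)%R by lia.
  pose c : edge (segment 0 n) := exist _ (Posz k) h.
  by exists c => //; rewrite (Te k c).
split.
- suff from_n x : subV (del_path t) x -> reach (subE (del_path t)) (T n) x.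
    apply/connected_subP => x y /from_n nx /from_n; apply: reach_trans.
    exact: reach_sym.
  move=> [e ne ex]; have [k [kE _]] := eT e.
  have nk : n <= k by apply: early; rewrite kE.
  have ek : incident e (T k)
    by rewrite -kE; apply/(joins_incident _ (ray_joins T k)); left.
  apply: reach_trans (reach_edge (A := subE (del_path t)) ne ek ex).
  have := ray_walk T n (k - n); rewrite subnKC //; set q := map _ _ => wq.
  exists q => // f.
  rewrite /edges -map_comp => /(@mapP nat)[l].
  rewrite mem_iota => /andP[nl _] ->.
  by move=> /late; rewrite ltnNge nl.
- by rewrite -T0; apply/(distinguished_only_odd_at _ hG)/eulerian_ray_only_odd_at.
- exists (hom_edge T n); split.
    by rewrite -Tn; apply/(joins_incident _ (ray_joins T n)); left.
  by move/late; rewrite ltnn.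
Qed.
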